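(* Let $q$ be a prime power and let $n, i \ge 2$ be integers. The $i$-th Whitney number of $\mathcal{H}(q,n,n-1)$ is $$w_i(q,n,n-1)=\begin{bmatrix} n-1 \\ i \end{bmatrix}_q(-1)^iq^{\binom{i}{2}} -\begin{bmatrix} n-1 \\ i-1 \end{bmatrix}_q(-1)^{i-1}q^{\binom{i-1}{2}} \sum_{j=1}^{n-1} \binom{n-1}{j-1} (q-1)^{j-1}.$$
   Context: $\begin{bmatrix} r\\ s\end{bmatrix}_q$ is the $q$-binomial coefficient ($0$ if $s<0$ or $s>r$). The Hamming weight of $v \in \mathbb{F}_q^n$ is the number of its nonzero coordinates. For integers $n,d\ge 1$, the higher-weight Dowling lattice $\mathcal{H}(q,n,d)$ is the set, ordered by inclusion, of all $\mathbb{F}_q$-linear subspaces of $\mathbb{F}_q^n$ that have a basis made of vectors of Hamming weight at most $d$, together with the zero space. It is a finite geometric lattice whose rank function is the $\mathbb{F}_q$-dimension. With $\mu$ the Möbius function of $\mathcal{H}(q,n,d)$, the $i$-th Whitney number (of the first kind) is $w_i(q,n,d)=\sum_{U \in \mathcal{H}(q,n,d),\ \dim U=i} \mu(\{0\},U)$ (an empty sum is $0$). *)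

(* Defs.v *)
From HB Require Import structures.
From mathcomp Require Import all_boot all_order all_algebra.
Set Implicit Arguments.
Unset Strict Implicit.
Unset Printing Implicit Defensive.
Import Order.TTheory GRing.Theory Num.Theory.
Local Open Scope ring_scope.

Section Mobius.
Variables (disp : Order.disp_t) (T : finPOrderType disp).
Implicit Types x y z : T.

(* The fuel k only makes the recursion structural: an interval of T has at
   most #|T| elements, and mobiusE is the usual recursion without fuel. *)
Fixpoint mobius_rec (k : nat) x y : int :=
  if k is k'.+1 then
    if x == y then 1
    else - \sum_(z : T | (x <= z)%O && (z < y)%O) mobius_rec k' x z
  else 0.

Definition mobius x y : int := mobius_rec #|T| x y.

Let below y : nat := #|[set z : T | (z <= y)%O]|.

Let below_gt0 y : (0 < below y)%N.
Proof. by apply/card_gt0P; exists y; rewrite inE. Qed.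

Let below_lt z y : (z < y)%O -> (below z < below y)%N.
Proof.
move=> ltzy; apply/proper_card/properP; split.
  by apply/subsetP => t; rewrite !inE => /le_trans; apply; apply: ltW.
by exists y; rewrite !inE ?lexx ?lt_geF.
Qed.

Let mobius_rec_fuel k l x y :
  (below y <= k)%N -> (below y <= l)%N -> mobius_rec k x y = mobius_rec l x y.
Proof.
elim: k l y => [|k IHk] [|l] y //= Hk Hl.
- by have := leq_trans (below_gt0 y) Hk.
- by have := leq_trans (below_gt0 y) Hl.
case: eqP => // _; congr (- _); apply: eq_bigr => z /andP[_ ltzy].
by apply: IHk; rewrite -ltnS; apply: leq_trans (below_lt ltzy) _.
Qed.

Lemma mobiusE x y :
  mobius x y =
    if x == y then 1
    else - \sum_(z : T | (x <= z)%O && (z < y)%O) mobius x z.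
Proof.
have le_below z : (below z <= #|T|)%N by apply: max_card.
rewrite {1}/mobius (@mobius_rec_fuel _ #|T|.+1) ?leqW //=.
Qed.

Lemma mobius_refl x : mobius x x = 1.
Proof. by rewrite mobiusE eqxx. Qed.

Lemma mobius_sum0 x y :
  (x < y)%O -> \sum_(z : T | (x <= z <= y)%O) mobius x z = 0.
Proof.
move=> ltxy; rewrite (bigD1 y) /=; last by rewrite (ltW ltxy) lexx.
rewrite mobiusE lt_eqF // addrC; apply/eqP; rewrite subr_eq0; apply/eqP.
by apply: eq_bigl => z; rewrite lt_neqAle -andbA [in RHS](andbC (z != y)).
Qed.

End Mobius.

Section FiniteSubspaces.
Import VectorInternalTheory.
Variables (F : finFieldType) (vT : vectType F).

HB.instance Definition _ := [Countable of {vspace vT} by <:].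
HB.instance Definition _ := [Finite of {vspace vT} by <:].

End FiniteSubspaces.

Definition hamming_weight (F : finFieldType) (n : nat) (v : 'rV[F]_n) : nat :=
  #|[set j : 'I_n | v 0 j != 0]|.

Section DowlingLattice.
Variables (F : finFieldType) (n d : nat).

Definition dowling_pred (U : {vspace 'rV[F]_n}) : bool :=
  (U == 0%VS) ||
  [exists X : (\dim U).-tuple 'rV[F]_n,
     basis_of U X && all (fun v => (hamming_weight v <= d)%N) X].

Record dowling_lattice := DowlingSpace {
  dowling_space :> {vspace 'rV[F]_n};
  dowling_spaceP : dowling_pred dowling_space }.

HB.instance Definition _ := [isSub for dowling_space].
HB.instance Definition _ := [Finite of dowling_lattice by <:].

Let dowling_le (U V : dowling_lattice) : bool := (U <= V)%VS.

Let dowling_le_refl : reflexive dowling_le.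
Proof. by move=> U; apply: subvv. Qed.

Let dowling_le_anti : antisymmetric dowling_le.
Proof. by move=> U V UV; apply/val_inj/subv_anti. Qed.

Let dowling_le_trans : transitive dowling_le.
Proof. by move=> V U W; apply: subv_trans. Qed.

Fact dowling_display : Order.disp_t. Proof. exact: Order.Disp tt tt. Qed.

HB.instance Definition _ := Order.Le_isPOrder.Build dowling_display
  dowling_lattice dowling_le_refl dowling_le_anti dowling_le_trans.

Lemma dowling_leE (U V : dowling_lattice) :
  (U <= V)%O = (dowling_space U <= dowling_space V)%VS.
Proof. by []. Qed.

Fact dowling0_subproof : dowling_pred 0%VS.
Proof. by rewrite /dowling_pred eqxx. Qed.

Definition dowling0 : dowling_lattice := DowlingSpace dowling0_subproof.

Definition whitney (i : nat) : int :=
  \sum_(U : dowling_lattice | \dim U == i) mobius dowling0 U.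

End DowlingLattice.

Definition qbinom (q r s : nat) : rat :=
  if (s <= r)%N then
    \prod_(k < s) ((q%:R ^+ (r - k) - 1) / (q%:R ^+ k.+1 - 1))
  else 0.

(* Main.v *)
Require Import Defs.
From mathcomp Require Import all_boot all_order all_algebra.
From mathcomp Require Import ring.
Import Order.TTheory GRing.Theory Num.Theory.
Local Open Scope ring_scope.
Set Implicit Arguments.
Unset Strict Implicit.
Unset Printing Implicit Defensive.

(** The proof rests on a modular coatom, in the spirit of Stanley's
    factorization of characteristic polynomials of geometric lattices.

    Call a vector light if its weight is at most d, and let W_m be the space of
    the vectors whose coordinates of index m, m + 1, ... vanish. For m <= d all
    vectors of W_m are light, so every subspace of W_m is a flat of H(q,n,d).
    Let A be the set of light u in W_(m+1) with u_m = 1. For a fixed u in A, the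
    maps V |-> V :&: W_m and Y |-> Y + <[u]> are inverse bijections between the
    flats V with u in V <= W_(m+1) and the subspaces Y of W_m
    ([sum_line_join]). Hence the function

      f V = [V <= W_m] mu(0, V) - #|A :&: V| mu(0, V :&: W_m)

    satisfies, for every U <= W_(m+1),

      \sum_(V <= U) f V = (1 - #|A :&: U|) * \sum_(Y <= U :&: W_m) mu(0, Y),

    which vanishes for U != 0: either U :&: W_m != 0 and the last sum is zero,
    or U is a line spanned by exactly one element of A. So f V = mu(0, V) for
    all flats V <= W_(m+1) ([coatom_mobiusE]). Summing over dimensions, the
    Whitney numbers w(m, i) of the flats below W_m satisfy

      w(m+1, i+1) = w(m, i+1) - #|A| w(m, i)    ([flag_whitneyS]).

    Now let d = n - 1. For m < n - 1 every vector of W_(m+1) is light and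
    #|A| = q^m, so the recursion is the q-Pascal rule and gives
    w(m, i) = qbinom m i (-1)^i q^'C(i,2) for m <= n - 1, without any count of
    subspaces ([flag_whitney_subspaces]). For m = n - 1 the heavy vectors with
    last coordinate 1 are those without zero coordinate, so
    #|A| = q^(n-1) - (q-1)^(n-1), which is the sum of the theorem by the
    binomial formula. One more step of the recursion gives the result. *)

(** * Möbius functions *)

(** The vanishing of the interval sums above x determines the Möbius function;
    they are only required below b, because the closed form of
    [coatom_mobius] is valid only below W_(m+1). *)
Lemma mobius_unique (disp : Order.disp_t) (T : finPOrderType disp)
    (x b : T) (f : T -> int) :
    f x = 1 ->
    (forall y, (x < y)%O -> (y <= b)%O ->
       \sum_(z : T | (x <= z <= y)%O) f z = 0) ->
  forall y, (x <= y)%O -> (y <= b)%O -> f y = mobius x y.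
Proof.
move=> fx1 sumf0 y; have [k] := ubnP #|[set z : T | (z <= y)%O]|.
elim: k y => // k IHk y leyk lexy leyb.
rewrite mobiusE; case: eqVneq => [<- // | neqxy].
have ltxy : (x < y)%O by rewrite lt_neqAle neqxy.
have := sumf0 y ltxy leyb; rewrite (bigD1 y) /= ?lexy ?lexx //.
move/eqP; rewrite addr_eq0 => /eqP->; congr (- _).
rewrite (eq_bigl (fun z => (x <= z)%O && (z < y)%O)); last first.
  by move=> z; rewrite lt_neqAle -andbA (andbC (z != y)).
apply: eq_bigr => z /andP[lexz ltzy].
apply: IHk => //; last exact: le_trans (ltW ltzy) leyb.
rewrite ltnS in leyk; apply: leq_trans leyk.
apply/proper_card/properP; split.
  by apply/subsetP=> t; rewrite !inE => /le_trans; apply; apply: ltW.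
by exists y; rewrite !inE ?lexx ?lt_geF.
Qed.

(** * Flats and the coordinate flag *)

Section Flats.
Variables (F : finFieldType) (n d : nat).
Implicit Types (u v : 'rV[F]_n) (U V Y : {vspace 'rV[F]_n}).

Definition light v := (hamming_weight v <= d)%N.

Lemma dowling_pred_basis U (X : seq 'rV[F]_n) :
  basis_of U X -> all light X -> dowling_pred d U.
Proof.
move=> basX lightX; apply/orP; right; apply/existsP.
have szX : size X == \dim U.
  by rewrite -(span_basis basX) (eqnP (basis_free basX)).
by exists (Tuple szX); apply/andP.
Qed.

Lemma dowling_pred_sub_light U :
  {in U, forall v, light v} -> dowling_pred d U.
Proof.
move=> lightU; apply: dowling_pred_basis (vbasisP U) _.
by apply/allP=> v /vbasis_mem/lightU.
Qed.

Lemma dowling_pred_line U u :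
  dowling_pred d U -> light u -> u \notin U -> dowling_pred d (U + <[u]>).
Proof.
move=> dU lu nUu.
have [X basX lX] : exists2 X, basis_of U X & all light X.
  case/orP: dU => [/eqP->|/existsP[X /andP[bX lX]]]; last by exists X.
  by exists [::] => //; apply/andP; rewrite span_nil nil_free.
apply: (@dowling_pred_basis _ (u :: X)); last by rewrite /= lu.
by rewrite /basis_of free_cons span_cons (span_basis basX) nUu
  (basis_free basX) addvC eqxx.
Qed.

(** A flat is generated by its light vectors, so they cannot all lie in a
    subspace that does not contain it. *)
Lemma dowling_pred_notin U V : dowling_pred d U -> ~~ (U <= V)%VS ->
  exists2 u, u \in U & light u && (u \notin V).
Proof.
case/orP=> [/eqP-> | /existsP[X /andP[bX /allP lX]] nUV]; first by rewrite sub0v.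
have : ~~ all (mem V) X.
  apply: contra nUV => /allP sXV.
  by rewrite -(span_basis bX); apply/span_subvP.
case/allPn=> u Xu nVu; exists u; first exact: (basis_mem bX).
by rewrite /light lX.
Qed.

Lemma capv_line_notin U u : u \notin U -> (U :&: <[u]> = 0)%VS.
Proof.
move=> nUu; apply/eqP; rewrite -subv0; apply/subvP=> v; rewrite memv_cap memv0.
case/andP=> Uv /vlineP[k vE]; move: Uv; rewrite vE.
have [-> | nzk] := eqVneq k 0; first by rewrite scale0r.
by rewrite rpredZeq (negPf nzk) (negPf nUu).
Qed.

(** The vectors supported on the first m coordinates. *)
Definition coord_flag (m : nat) : {vspace 'rV[F]_n} :=
  lker (linfun (mulmxr (copid_mx m : 'M[F]_n))).

Lemma coord_flagP m v :
  reflect (forall j : 'I_n, (m <= j)%N -> v 0 j = 0) (v \in coord_flag m).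
Proof.
have E j : (v *m copid_mx m) 0 j = if (m <= j)%N then v 0 j else 0.
  rewrite /copid_mx mulmxBr mulmx1 !mxE (bigD1 j) //= big1 => [|k nkj].
    by rewrite mxE eqxx /= ltnNge; case: leqP; rewrite addr0 ?mulr0 ?mulr1 ?subr0 ?subrr.
  by rewrite mxE (inj_eq val_inj) (negPf nkj) mulr0.
rewrite memv_ker lfunE /=; apply: (iffP eqP) => [v0 j lemj | v0].
  by have := E j; rewrite v0 lemj mxE.
by apply/rowP=> j; rewrite E mxE; case: ifP => // /v0.
Qed.

Lemma coord_flag0 : coord_flag 0 = 0%VS.
Proof.
apply/eqP; rewrite -subv0; apply/subvP=> v /coord_flagP v0.
by rewrite memv0; apply/eqP/rowP=> j; rewrite v0 ?mxE.
Qed.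

Lemma coord_flag_full : coord_flag n = fullv.
Proof.
apply/eqP; rewrite eqEsubv subvf.
by apply/subvP=> v _; apply/coord_flagP => j; rewrite leqNgt ltn_ord.
Qed.

Lemma coord_flagS m : (coord_flag m <= coord_flag m.+1)%VS.
Proof.
by apply/subvP=> v /coord_flagP v0; apply/coord_flagP=> j /ltnW/v0.
Qed.

Lemma light_coord_flag m v : (m <= d)%N -> v \in coord_flag m -> light v.
Proof.
move=> lemd /coord_flagP v0; apply: leq_trans lemd.
have [lenm | /ltnW lemn] := leqP n m.
  by apply: leq_trans lenm; rewrite -[leqRHS]card_ord; apply: max_card.
rewrite -[leqRHS]card_ord; apply: leq_trans (leq_imset_card (widen_ord lemn) _).
apply/subset_leq_card/subsetP=> j; rewrite inE => nzj.
have ltjm : (j < m)%N by apply: contraNT nzj; rewrite -leqNgt => /v0->.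
by apply/imsetP; exists (Ordinal ltjm) => //; apply: val_inj.
Qed.

End Flats.

(** * The modular coatom of the coordinate flag *)

Section ModularCoatom.
Variables (F : finFieldType) (n d : nat) (m : 'I_n).
Hypothesis lemd : (m <= d)%N.

Let L : finPOrderType _ := dowling_lattice F n d.
Let H : {vspace 'rV[F]_n} := coord_flag F n m.
Let E : {vspace 'rV[F]_n} := coord_flag F n m.+1.
Implicit Types (u v : 'rV[F]_n) (U V Y : L).

(** The atoms below W_(m+1) but not below W_m, each represented by its vector
    normalized at the coordinate m. *)
Definition light_coset : {set 'rV[F]_n} :=
  [set u | [&& u \in coord_flag F n m.+1, u 0 m == 1 & light d u]].

Lemma mem_coord_flag_coord v : v \in E -> (v \in H) = (v 0 m == 0).
Proof.
move=> /coord_flagP vE; apply/coord_flagP/eqP=> [->// | v0 j].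
by rewrite leq_eqVlt => /predU1P[/val_inj<- // | /vE].
Qed.

Lemma light_coset_notin u : u \in light_coset -> u \notin H.
Proof.
by rewrite inE => /and3P[uE /eqP u1 _]; rewrite mem_coord_flag_coord // u1 oner_eq0.
Qed.

Lemma coord_flag_line u : u \in light_coset -> (H + <[u]>)%VS = E.
Proof.
rewrite inE => /and3P[uE /eqP u1 _]; apply/subv_anti.
rewrite subv_add coord_flagS -memvE uE /=.
apply/subvP=> v vE; rewrite -[v](subrK (v 0 m *: u)) memv_add ?memvZ ?memv_line //.
rewrite mem_coord_flag_coord; last by rewrite rpredB ?rpredZ.
by rewrite !mxE u1 mulr1 subrr.
Qed.

Lemma dowling_pred_coord_flag (W : {vspace 'rV[F]_n}) :
  (W <= H)%VS -> dowling_pred d W.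
Proof.
move=> /subvP sWH; apply: dowling_pred_sub_light => v /sWH.
exact: light_coord_flag.
Qed.

(** [insubd] returns the intersection itself, as every subspace of W_m is a flat. *)
Definition flag_meet V : L := insubd (dowling0 F n d) (V :&: H)%VS.

Lemma flag_meetE V : dowling_space (flag_meet V) = (V :&: H)%VS.
Proof. exact/insubdK/dowling_pred_coord_flag/capvSr. Qed.

(** Used only for u in the light coset and Y below W_m, where the sum is a flat. *)
Definition line_join u Y : L := insubd (dowling0 F n d) (Y + <[u]>)%VS.

Lemma line_joinE u Y : u \in light_coset -> (Y <= H)%VS ->
  dowling_space (line_join u Y) = (Y + <[u]>)%VS.
Proof.
move=> Au sYH; apply/insubdK/dowling_pred_line; first exact: dowling_spaceP.
  by move: Au; rewrite inE => /and3P[].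
by apply: contra (light_coset_notin Au); apply/subvP.
Qed.

Lemma line_joinK u Y : u \in light_coset -> (Y <= H)%VS ->
  flag_meet (line_join u Y) = Y.
Proof.
move=> Au sYH; apply: val_inj; rewrite /= flag_meetE line_joinE //.
by rewrite -vspace_modl // capvC capv_line_notin ?light_coset_notin ?addv0.
Qed.

Lemma flag_meetK u V : u \in light_coset -> (V <= E)%VS -> u \in dowling_space V ->
  line_join u (flag_meet V) = V.
Proof.
move=> Au sVE Vu; apply: val_inj; rewrite /= line_joinE // flag_meetE ?capvSr //.
by rewrite vspace_modr ?coord_flag_line //; apply/capv_idPl.
Qed.

Lemma dim_line_join u Y : u \in light_coset -> (Y <= H)%VS ->
  \dim (line_join u Y) = (\dim Y).+1.
Proof.
move=> Au sYH; have nHu := light_coset_notin Au.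
have nYu : u \notin dowling_space Y by apply: contra nHu; apply/subvP.
rewrite line_joinE // dimv_disjoint_sum ?capv_line_notin // dim_vline.
have -> : u != 0 by apply: contraNneq nHu => ->; rewrite mem0v.
by rewrite addn1.
Qed.

(** For fixed u, intersecting with W_m and adjoining u are inverse bijections
    between the flats through u and the subspaces of W_m; the dimension drops by
    one. Letting g depend on the dimension serves both the interval sums and the
    Whitney numbers. *)
Lemma sum_line_join u (U : {vspace 'rV[F]_n}) (g : L -> nat -> int) :
    u \in light_coset -> (U <= E)%VS -> u \in U ->
  \sum_(V : L | (V <= U)%VS && (u \in dowling_space V)) g (flag_meet V) (\dim V) =
  \sum_(Y : L | (Y <= U :&: H)%VS) g Y (\dim Y).+1.
Proof.
move=> Au sUE Uu; rewrite (reindex_onto (line_join u) flag_meet) /=; last first.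
  move=> V /andP[sVU Vu]; apply: flag_meetK => //; exact: subv_trans sVU sUE.
apply: eq_big => [Y | Y /andP[_ /eqP YK]].
  apply/andP/idP=> [[/andP[sYU _] /eqP YK] | ].
    by rewrite -YK flag_meetE capvS.
  rewrite subv_cap => /andP[sYU sYH].
  by rewrite line_joinK // line_joinE // subv_add sYU -memvE Uu /= memvE addvSr.
have sYH : (Y <= H)%VS by rewrite -YK flag_meetE capvSr.
by rewrite YK dim_line_join.
Qed.

(** The closed form of the Möbius function on the flats below W_(m+1). At most one
    of the two terms is nonzero, but keeping both avoids a case distinction when
    summing. *)
Definition coatom_mobius V : int :=
  (if (V <= H)%VS then mobius (dowling0 F n d) V else 0)
  - \sum_(u in light_coset | u \in dowling_space V) mobius (dowling0 F n d) (flag_meet V).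

(** Exchange the sums over V and over u, then reindex the flats through each u by
    [sum_line_join]. The predicate p on dimensions is constant for the interval
    sums and fixes the dimension for the Whitney numbers. *)
Lemma sum_coatom_mobius (U : {vspace 'rV[F]_n}) (p : pred nat) : (U <= E)%VS ->
  \sum_(V : L | (V <= U)%VS && p (\dim V)) coatom_mobius V =
  \sum_(Y : L | (Y <= U :&: H)%VS && p (\dim Y)) mobius (dowling0 F n d) Y
  - \sum_(u in light_coset | u \in U)
      \sum_(Y : L | (Y <= U :&: H)%VS && p (\dim Y).+1) mobius (dowling0 F n d) Y.
Proof.
move=> sUE; rewrite sumrB; congr (_ - _).
  by rewrite -big_mkcondr; apply: eq_bigl => V; rewrite subv_cap -andbA andbAC -andbA.
under eq_bigr do rewrite big_mkcondr.
rewrite exchange_big /= [RHS]big_mkcondr; apply: eq_bigr => u Au.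
case: ifPn => [Uu | nUu]; last first.
  by apply: big1 => V /andP[/subvP sVU _]; rewrite ifN //; apply: contra nUu => /sVU.
pose g Y k := if p k then mobius (dowling0 F n d) Y else 0.
have := sum_line_join g Au sUE Uu; rewrite /g -[X in _ = X -> _]big_mkcondr => <-.
by rewrite -!big_mkcondr; apply: eq_bigl => V; rewrite andbAC.
Qed.

Lemma dowling0_le V : (dowling0 F n d <= V)%O.
Proof. by rewrite dowling_leE sub0v. Qed.

Lemma dowling0_lt V : (dowling0 F n d < V)%O = (dowling_space V != 0%VS).
Proof. by rewrite lt_neqAle dowling0_le andbT eq_sym -val_eqE. Qed.

(** Since U is itself a flat here, this sum runs over an interval of the lattice. *)
Lemma sum_mobius_dowling (U : {vspace 'rV[F]_n}) : (U <= H)%VS ->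
  \sum_(Y : L | (Y <= U)%VS) mobius (dowling0 F n d) Y = (U == 0%VS)%:R.
Proof.
move=> sUH; pose U' : L := DowlingSpace (dowling_pred_coord_flag sUH).
rewrite (eq_bigl (fun Y => dowling0 F n d <= Y <= U')%O); last first.
  by move=> Y; rewrite dowling0_le.
have [U0 | nzU] := eqVneq U 0%VS; last by rewrite mobius_sum0 // dowling0_lt.
rewrite (big_pred1 (dowling0 F n d)) ?mobius_refl // => Y /=.
by rewrite dowling0_le dowling_leE /= U0 subv0 -val_eqE.
Qed.

(** Such a U is a line, which contains a light vector outside W_m because it is a
    flat; normalizing the coordinate m leaves one choice. *)
Lemma card_light_coset_line U : (U <= E)%VS -> dowling_space U != 0%VS ->
  (U :&: H = 0)%VS -> #|[set u in light_coset | u \in dowling_space U]| = 1%N.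
Proof.
move=> sUE nzU UH0.
have nUH : ~~ (U <= H)%VS by apply: contra nzU => /capv_idPl <-; rewrite UH0.
have [v Uv /andP[lv nHv]] := dowling_pred_notin (dowling_spaceP U) nUH.
have vE := subvP sUE _ Uv.
have nz : v 0 m != 0 by rewrite -mem_coord_flag_coord.
apply/eqP/cards1P; exists ((v 0 m)^-1 *: v); apply/setP=> w; rewrite !inE.
apply/andP/eqP=> [[/and3P[wE /eqP w1 _] Uw] | ->].
  apply/eqP; rewrite -subr_eq0 -memv0 -UH0 memv_cap rpredB ?rpredZ //=.
  by rewrite mem_coord_flag_coord ?rpredB ?rpredZ // !mxE mulVf // w1 subrr.
rewrite !rpredZ // mxE mulVf // eqxx; split=> //=.
apply: leq_trans lv; apply/subset_leq_card/subsetP=> j; rewrite !inE mxE.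
by rewrite mulf_eq0 negb_or => /andP[].
Qed.

(** By [sum_coatom_mobius], the sum over the flats below a nonzero U is a sum of
    mu(0, Y) over Y <= U :&: W_m times 1 - #|A :&: U|. The first factor vanishes
    unless U :&: W_m = 0, and then the second one does. *)
Lemma coatom_mobiusE V : (V <= E)%VS -> coatom_mobius V = mobius (dowling0 F n d) V.
Proof.
move=> sVE; apply: (@mobius_unique _ L (dowling0 F n d) V); rewrite ?dowling0_le ?lexx //.
  rewrite /coatom_mobius sub0v mobius_refl big_pred0 ?subr0 // => u.
  apply/negP=> /andP[/light_coset_notin]; rewrite /= memv0 => + /eqP u0.
  by rewrite u0 mem0v.
move=> U; rewrite dowling0_lt dowling_leE => nzU sUV.
have sUE := subv_trans sUV sVE.
rewrite (eq_bigl (fun W : L => (W <= U)%VS && predT (\dim W))); last first.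
  by move=> W; rewrite dowling0_le andbT.
have sumUH : \sum_(Y : L | (Y <= U :&: H)%VS && true) mobius (dowling0 F n d) Y =
    ((U :&: H)%VS == 0%VS)%:R.
  by under eq_bigl do rewrite andbT; apply: sum_mobius_dowling; apply: capvSr.
rewrite (sum_coatom_mobius predT sUE) /= !sumUH sumr_const.
have [UH0 | nzUH] := eqVneq (dowling_space U :&: H)%VS 0%VS; last by rewrite mul0rn subrr.
apply/eqP; rewrite subr_eq0 eq_sym -[eqbRHS]mulr1n; apply/eqP; congr (_ *+ _).
apply: etrans (card_light_coset_line sUE nzU UH0).
by apply: eq_card => u; rewrite inE.
Qed.

Definition flag_whitney (k i : nat) : int :=
  \sum_(U : L | (U <= coord_flag F n k)%VS && (\dim U == i)) mobius (dowling0 F n d) U.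

(** This is the factor t - #|A| that a modular coatom contributes to the
    characteristic polynomial. *)
Lemma flag_whitneyS i : flag_whitney m.+1 i.+1 =
  flag_whitney m i.+1 - flag_whitney m i *+ #|light_coset|.
Proof.
rewrite /flag_whitney.
rewrite (eq_bigr coatom_mobius) => [|U /andP[sUE _]]; last by rewrite coatom_mobiusE.
rewrite (sum_coatom_mobius (pred1 i.+1)) //.
rewrite (capv_idPr (coord_flagS _ _ _)); congr (_ - _).
rewrite /= sumr_const; congr (_ *+ _).
apply: eq_card => u; apply/andP/idP=> [[]// | Au]; split=> //.
by move: Au; rewrite inE => /and3P[].
Qed.

End ModularCoatom.

(** * The sizes of the light cosets *)

Section Counting.
Variables (F : finFieldType) (n : nat).

Lemma card_box (B : 'I_n -> pred F) :
  #|[set v : 'rV[F]_n | [forall j, B j (v 0 j)]]| = (\prod_(j < n) #|B j|)%N.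
Proof.
pose row_of (f : {ffun 'I_n -> F}) : 'rV[F]_n := \row_j f j.
have row_of_inj : injective row_of.
  by move=> f g /rowP fg; apply/ffunP=> j; have := fg j; rewrite !mxE.
transitivity #|[set row_of f | f in family B]|.
  apply: eq_card => v; rewrite inE; apply/forallP/imsetP=> [Bv | [f /familyP Bf ->] j].
    exists [ffun j => v 0 j]; last by apply/rowP=> j; rewrite !mxE ffunE.
    by apply/familyP=> j; rewrite ffunE; apply: Bv.
  by rewrite mxE; apply: Bf.
by rewrite card_imset // card_family foldrE big_image.
Qed.

Lemma card_light_coset_lt d (m : 'I_n) : (m < d)%N ->
  #|light_coset F d m| = (#|F| ^ m)%N.
Proof.
move=> ltmd.
pose B (j : 'I_n) : pred F :=
  if (j < m)%N then predT else if j == m then pred1 1 else pred1 0.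
transitivity #|[set v : 'rV[F]_n | [forall j, B j (v 0 j)]]|.
  apply: eq_card => v; rewrite !inE; apply/and3P/forallP.
    case=> /coord_flagP v0 /eqP v1 _ j; rewrite /B.
    case: (ltngtP j m) => [// | ltmj | /val_inj ->]; last by rewrite eqxx /= v1.
    by rewrite -val_eqE gtn_eqF //= v0.
  move=> Bv; have vE : v \in coord_flag F n m.+1.
    apply/coord_flagP=> j ltmj; have := Bv j.
    by rewrite /B ltnNge (ltnW ltmj) -val_eqE gtn_eqF //= => /eqP.
  split=> //; last exact: light_coord_flag vE.
  by have := Bv m; rewrite /B ltnn eqxx.
rewrite card_box -[in RHS](card_ord m) -prod_nat_const.
rewrite (big_ord_widen _ (fun=> #|F|) (ltnW (ltn_ord m))) [RHS]big_mkcond.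
by apply: eq_bigr => j _; rewrite /B; case: ifP => // _; case: ifP => _; rewrite card1.
Qed.

End Counting.

(** Removed are the vectors without zero coordinate: only they have weight m + 1. *)
Lemma card_light_coset_max (F : finFieldType) (m : nat) :
  #|light_coset F m (ord_max : 'I_m.+1)| = (#|F| ^ m - (#|F| - 1) ^ m)%N.
Proof.
pose B (C : pred F) (j : 'I_m.+1) : pred F := if (j < m)%N then C else pred1 1.
pose box C := [set v : 'rV[F]_m.+1 | [forall j, B C j (v 0 j)]].
have card_boxE C : #|box C| = (#|C| ^ m)%N.
  rewrite card_box big_ord_recr /= {2}/B ltnn card1 muln1.
  rewrite (eq_bigr (fun=> #|C|)) => [|j _]; last by rewrite /B /= ltn_ord.
  by rewrite prod_nat_const card_ord.
have memB C v : (v \in box C) =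
    (v 0 ord_max == 1) && [forall j : 'I_m.+1, (j < m)%N ==> C (v 0 j)].
  rewrite inE; apply/forallP/andP=> [Bv | [v1 /forallP Cv] j].
    split; first by have := Bv ord_max; rewrite /B ltnn.
    by apply/forallP=> j; apply/implyP=> ltjm; have := Bv j; rewrite /B ltjm.
  rewrite /B; case: ifPn => [|]; first exact/implyP.
  rewrite -leqNgt => lemj; suff -> : j = ord_max by [].
  by apply/val_inj/anti_leq; rewrite /= lemj -ltnS ltn_ord.
have sub_box : box (predC1 0) \subset box predT.
  apply/subsetP=> v; rewrite !memB => /andP[-> _].
  by apply/forallP=> j; apply/implyP.
have -> : light_coset F m ord_max = box predT :\: box (predC1 0).
  apply/setP=> v; rewrite in_setD !memB !inE /= coord_flag_full memvf /=.
  case: eqP => //= v1; rewrite [X in _ = _ && X](_ : _ = true); last first.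
    by apply/forallP=> j; apply/implyP.
  rewrite andbT /light /hamming_weight.
  apply/idP/forallPn => [lightv | [j]].
    have : [set j | v 0 j != 0] != setT.
      by apply: contraTneq lightv => ->; rewrite cardsT card_ord ltnn.
    rewrite -subTset => /subsetPn[j _]; rewrite inE negbK => /eqP vj0.
    exists j; rewrite vj0 /= eqxx implybF negbK ltn_neqAle -ltnS ltn_ord andbT.
    apply/eqP=> /(@val_inj _ _ _ j ord_max) jE.
    by move/eqP: v1; rewrite -jE vj0 eq_sym oner_eq0.
  rewrite negb_imply /= negbK => /andP[_ /eqP vj0].
  rewrite -ltnS -[X in (_ < X)%N](card_ord m.+1) -cardsT; apply/proper_card.
  by rewrite properT; apply/negP=> /eqP/setP/(_ j); rewrite !inE vj0 eqxx.
rewrite cardsD (setIidPr sub_box) !card_boxE; congr (_ - _ ^ _)%N.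
by rewrite subn1 cardC1.
Qed.

(** The binomial expansion of (1 + (x - 1))^m without its top term. *)
Lemma sum_binomial_subr1 (R : comPzRingType) (x : R) (m : nat) :
  \sum_(1 <= j < m.+1) 'C(m, j - 1)%:R * (x - 1) ^+ (j - 1) = x ^+ m - (x - 1) ^+ m.
Proof.
have {2}-> : x = 1 + (x - 1) by rewrite addrC subrK.
rewrite big_add1 /= exprDn big_ord_recr /= subnn binn expr0 mul1r mulr1n addrK.
rewrite big_mkord; apply: eq_bigr => j _.
by rewrite subn1 /= expr1n mul1r mulr_natl.
Qed.

(** * q-binomial coefficients and Whitney numbers *)

(** For s > r the truncated subtraction makes the factor of index r equal to
    q^0 - 1 = 0, so the product vanishes as it should. *)
Lemma qbinomE (q r s : nat) :
  qbinom q r s = \prod_(k < s) ((q%:R ^+ (r - k) - 1) / (q%:R ^+ k.+1 - 1)).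
Proof.
rewrite /qbinom; case: leqP => // ltrs.
by rewrite (bigD1 (Ordinal ltrs)) //= subnn expr0 subrr !mul0r.
Qed.

(** The q-Pascal rule, from
    q^(r+1) - 1 = (q^(r-s) - 1) + q^(r-s) (q^(s+1) - 1). *)
Lemma qbinomS (q r s : nat) : (1 < q)%N ->
  qbinom q r.+1 s.+1 = qbinom q r s.+1 + q%:R ^+ (r - s) * qbinom q r s.
Proof.
move=> q_gt1.
have nz k : (q%:R ^+ k.+1 - 1 : rat) != 0.
  by rewrite subr_eq0 -natrX pnatr_eq1 -(exp1n k.+1) eqn_exp2r // gtn_eqF.
have [ltrs | lesr] := ltnP r s.
  by rewrite /qbinom !ltnS (ltnNge s r) (ltnW ltrs) leqNgt ltrs /= mulr0 addr0.
have -> : qbinom q r.+1 s.+1 =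
    (q%:R ^+ r.+1 - 1) / (q%:R ^+ s.+1 - 1) * qbinom q r s.
  rewrite !qbinomE !big_split /= !prodfV big_ord_recl [in X in _ * X]big_ord_recr /=.
  by rewrite invfM subn0 (mulrC (\prod_(_ < _) _)^-1) mulrACA.
rewrite [qbinom q r s.+1]qbinomE big_ord_recr -qbinomE /=.
have -> : q%:R ^+ r.+1 = q%:R ^+ (r - s) * q%:R ^+ s.+1 :> rat.
  by rewrite -exprD addnS subnK.
by field.
Qed.

Lemma flag_whitney0 (F : finFieldType) (n d m : nat) : flag_whitney F n d m 0 = 1.
Proof.
rewrite /flag_whitney (big_pred1 (dowling0 F n d)) ?mobius_refl // => U /=.
apply/andP/eqP=> [[_]|->]; last by rewrite /= sub0v dimv0.
by rewrite dimv_eq0 => /eqP U0; apply: val_inj.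
Qed.

Lemma flag_whitney_full (F : finFieldType) (n d i : nat) :
  flag_whitney F n d n i = whitney F n d i.
Proof. by apply: eq_bigl => U; rewrite coord_flag_full subvf. Qed.

(** The induction on m matches [flag_whitneyS] with the q-Pascal rule: the power of
    q absorbs the shift 'C(i+1,2) = 'C(i,2) + i. *)
Lemma flag_whitney_subspaces (F : finFieldType) (n d m i : nat) :
    (m <= d)%N -> (m <= n)%N ->
  (flag_whitney F n d m i)%:~R =
    qbinom #|F| m i * (-1) ^+ i * #|F|%:R ^+ 'C(i, 2) :> rat.
Proof.
elim: m i => [|m IHm] [|i] lemd lemn.
- by rewrite flag_whitney0 /qbinom big_ord0 !mul1r.
- rewrite /qbinom /= !mul0r /flag_whitney big_pred0 // => U.
  rewrite coord_flag0 subv0; apply/negP=> /andP[/eqP->].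
  by rewrite dimv0.
- by rewrite flag_whitney0 /qbinom big_ord0 !mul1r.
pose m' := Ordinal lemn.
rewrite (@flag_whitneyS F n d m' (ltnW lemd)) card_light_coset_lt //=.
rewrite rmorphB rmorphMn /= !IHm ?(ltnW lemd) ?(ltnW lemn) //.
rewrite qbinomS ?card_finNzRing_gt1 //.
rewrite 2!mulrDl; congr (_ + _).
rewrite -mulr_natr natrX binS bin1 exprD exprS.
have [ltmi | leim] := ltnP m i.
  by rewrite /qbinom leqNgt ltmi /= !(mul0r, mulr0) oppr0.
have -> : #|F|%:R ^+ m = #|F|%:R ^+ (m - i) * #|F|%:R ^+ i :> rat.
  by rewrite -exprD subnK.
by ring.
Qed.

Theorem theorem7p1 (F : finFieldType) (q n i : nat)
    (hq : #|F| = q) (hn : (2 <= n)%N) (hi : (2 <= i)%N) :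
  (whitney F n (n - 1) i)%:~R =
    qbinom q (n - 1) i * (-1) ^+ i * q%:R ^+ 'C(i, 2)
    - qbinom q (n - 1) (i - 1) * (-1) ^+ (i - 1) * q%:R ^+ 'C(i - 1, 2)
      * \sum_(1 <= j < n) 'C(n - 1, j - 1)%:R * (q%:R - 1) ^+ (j - 1) :> rat.
Proof.
subst q; case: n hn => // m m_gt0; case: i hi => // i _; rewrite !subn1 /=.
rewrite -flag_whitney_full (@flag_whitneyS F m.+1 m ord_max (leqnn m)).
rewrite card_light_coset_max rmorphB rmorphMn /= !flag_whitney_subspaces //.
rewrite sum_binomial_subr1; congr (_ - _); rewrite -[LHS]mulr_natr.
have q_gt0 : (0 < #|F|)%N := ltnW (card_finNzRing_gt1 F).
by rewrite natrB ?leq_exp2r ?leq_subr // !natrX natrB.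
Qed.
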